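(* For every integer $k\ge 1$, the oddness of $G_{\alpha}(2k+1;1,1,1)$ is 2.
   Context: Let $G$ be the graph with the 11 vertices $A,B,A',B',v,x_1,\dots,x_6$ and the 14 edges $Av,\ vA',\ Ax_6,\ x_6x_2,\ x_6x_5,\ x_2x_4,\ x_2B,\ x_4x_3,\ x_4B',\ x_3A',\ x_3x_5,\ x_5x_1,\ x_1B,\ x_1B'$. For $m\ge3$, $G_{\alpha}(m;1,1,1)$ is the cubic graph with vertex set $\{u_i: u\in V(G),\ i\in\mathbb{Z}_m\}\cup\{w_i: i\in\mathbb{Z}_m\}$ and edges $u_iu'_i$ for every edge $uu'$ of $G$, spoke edges $v_iw_i$, loop edges $w_iw_{i+1}$, and connecting edges $A'_iA_{i+1}$, $B'_iB_{i+1}$ (indices mod $m$). The oddness of a cubic graph is the minimum number of odd-length cycles in a 2-factor (spanning 2-regular subgraph). *)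

(* Defs.v *)
From HB Require Import structures.
From mathcomp Require Import all_boot.

Set Implicit Arguments.
Unset Strict Implicit.
Unset Printing Implicit Defensive.

(* A simple graph on the finite vertex type T is given by its adjacency
   relation e : rel T (symmetric and irreflexive); its edges are the
   unordered pairs [set x; y] with e x y. *)
Definition edges (T : finType) (e : rel T) : {set {set T}} :=
  [set f | [exists x, exists y, e x y && (f == [set x; y])]].

Definition degree_in (T : finType) (F : {set {set T}}) (x : T) : nat :=
  #|[set f in F | x \in f]|.

Definition two_factor (T : finType) (e : rel T) (F : {set {set T}}) : bool :=
  (F \subset edges e) && [forall x, degree_in F x == 2].

Definition components (T : finType) (F : {set {set T}}) : {set {set T}} :=
  [set [set y | connect [rel a b | [set a; b] \in F] x y] | x : T].

(* The components of a 2-factor are its cycles, and the length of a cycle is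
   the number of its vertices. *)
Definition odd_cycles (T : finType) (F : {set {set T}}) : nat :=
  #|[set C in components F | odd #|C|]|.

(* n is the minimum of odd_cycles over all 2-factors, attained by at least one
   of them; a relation, since a graph need not have a 2-factor. *)
Definition oddness_is (T : finType) (e : rel T) (n : nat) : Prop :=
  (exists2 F, two_factor e F & odd_cycles F = n) /\
  (forall F, two_factor e F -> n <= odd_cycles F).

Inductive G_vertex :=
  | vA | vB | vA' | vB' | vv | x1 | x2 | x3 | x4 | x5 | x6.

Definition G_vertices : seq G_vertex :=
  [:: vA; vB; vA'; vB'; vv; x1; x2; x3; x4; x5; x6].

Definition G_vertex_code (u : G_vertex) : nat :=
  match u with
  | vA => 0 | vB => 1 | vA' => 2 | vB' => 3 | vv => 4
  | x1 => 5 | x2 => 6 | x3 => 7 | x4 => 8 | x5 => 9 | x6 => 10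
  end.

Lemma G_vertex_codeK : cancel G_vertex_code (nth vA G_vertices).
Proof. by case. Qed.

HB.instance Definition _ := Countable.copy G_vertex (can_type G_vertex_codeK).

Lemma G_vertices_enum : Finite.axiom G_vertices.
Proof. by case. Qed.

HB.instance Definition _ := isFinite.Build G_vertex G_vertices_enum.

Definition G_edges : seq (G_vertex * G_vertex) :=
  [:: (vA, vv); (vv, vA'); (vA, x6); (x6, x2); (x6, x5); (x2, x4); (x2, vB);
      (x4, x3); (x4, vB'); (x3, vA'); (x3, x5); (x5, x1); (x1, vB); (x1, vB')].

(* inl (u, i) is u_i and inr i is w_i; indices are in 'I_m, with ordS i the
   index i + 1 mod m. *)
Definition Galpha_vertex (m : nat) : finType := (G_vertex * 'I_m + 'I_m)%type.

(* Each edge is listed here in one orientation only. *)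
Definition Galpha_arc (m : nat) : rel (Galpha_vertex m) := fun x y =>
  match x, y with
  | inl (u, i), inl (u', j) =>
      ((u, u') \in G_edges) && (j == i)
      || ((u, u') \in [:: (vA', vA); (vB', vB)]) && (j == ordS i)
  | inl (u, i), inr j => (u == vv) && (j == i)
  | inr i, inr j => j == ordS i
  | inr _, inl _ => false
  end.

(* The graph G_alpha(m;1,1,1), intended for m >= 3. *)
Definition Galpha (m : nat) : rel (Galpha_vertex m) :=
  fun x y => Galpha_arc x y || Galpha_arc y x.

Lemma Galpha_sym m : symmetric (@Galpha m).
Proof. by move=> x y; rewrite /Galpha orbC. Qed.

Lemma Galpha_irrefl m : 2 < m -> irreflexive (@Galpha m).
Proof.
move=> m_gt2; have ordS_neq (i : 'I_m) : (i == ordS i) = false.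
  apply/eqP => /(congr1 val) /= Ei.
  have [lt_i1m|ge_i1m] := ltnP i.+1 m.
    by move: (ltnSn i); rewrite {1}Ei modn_small // ltnn.
  have Em : i.+1 = m by apply/eqP; rewrite eqn_leq ltn_ord.
  by move: m_gt2; rewrite -Em Ei Em modnn.
rewrite /Galpha => -[[u i]|i] /=; rewrite !ordS_neq //.
by rewrite orbb andbF orbF; case: u.
Qed.

(* Main.v *)
Require Import Defs.
From mathcomp Require Import all_boot.

(* A 2-factor all of whose cycles are even would give a 3-edge-colouring.  Read the
   colours (a, b, l) of the three edges A'_{i-1}A_i, B'_{i-1}B_i, w_{i-1}w_i: a
   finite check on one block shows that passing to the next block always flips a
   parity attached to this triple, which is impossible around an odd number of
   blocks.  So every 2-factor has an odd cycle, hence at least two, as the number of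
   vertices 12m is even.  Conversely an explicit 2-factor has odd cycles only
   through w_0 and A_0. *)

Set Implicit Arguments.
Unset Strict Implicit.
Unset Printing Implicit Defensive.

(** * Edge sets, degrees, and the parity of the number of odd cycles *)

Lemma set2_injr (T : finType) (x : T) : injective (fun y => [set x; y]).
Proof.
move=> y z E.
have: y \in [set x; z] by rewrite -E !inE eqxx orbT.
have: z \in [set x; y] by rewrite E !inE eqxx orbT.
by rewrite !inE => /orP[/eqP-> /orP[]/eqP|/eqP].
Qed.

Definition edge_rel (T : finType) (F : {set {set T}}) : rel T :=
  fun a b => [set a; b] \in F.

Lemma edge_rel_sym (T : finType) (F : {set {set T}}) : symmetric (edge_rel F).
Proof. by move=> x y; rewrite /edge_rel setUC. Qed.

Lemma degree_in_card (T : finType) (F : {set {set T}}) (x : T) :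
  (forall f, f \in F -> #|f| = 2) ->
  degree_in F x = #|[set y | edge_rel F x y]|.
Proof.
move=> F2; rewrite -(card_imset _ (@set2_injr T x)); apply: eq_card => f.
rewrite inE; apply/andP/imsetP => [[fF xf] | [y]].
  have /eqP/cards2P[a [b [_ E]]] := F2 f fF.
  move: xf; rewrite E !inE => /orP[]/eqP E'; subst x.
    by exists b; rewrite // inE /edge_rel -E.
  by exists a; rewrite ?inE /edge_rel setUC // -E.
by rewrite inE /edge_rel => xyF ->; rewrite xyF !inE eqxx.
Qed.

Lemma edge_card (T : finType) (e : rel T) f :
  irreflexive e -> f \in edges e -> #|f| = 2.
Proof.
move=> e_irr; rewrite inE => /existsP[x /existsP[y /andP[exy /eqP ->]]].
by rewrite cards2; case: eqVneq exy => // ->; rewrite e_irr.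
Qed.

Lemma mem_edges (T : finType) (e : rel T) x y :
  symmetric e -> irreflexive e -> ([set x; y] \in edges e) = e x y.
Proof.
move=> e_sym e_irr; apply/idP/idP => [|exy]; last first.
  by rewrite inE; apply/existsP; exists x; apply/existsP; exists y; rewrite exy /=.
rewrite inE => /existsP[a /existsP[b /andP[eab /eqP E]]].
have: a \in [set x; y] by rewrite E !inE eqxx.
rewrite !inE => /orP[]/eqP Ea; subst a.
  by rewrite (set2_injr E).
by move: E; rewrite setUC => /set2_injr ->; rewrite e_sym.
Qed.

(** The components partition the vertices, so [#|T|] is the sum of their sizes; modulo 2 each of
    them counts exactly when it is odd. *)
Lemma odd_odd_cycles (T : finType) (F : {set {set T}}) :
  odd (odd_cycles F) = odd #|T|.
Proof.
have Fsym : connect_sym (edge_rel F) by apply: sym_connect_sym; exact: edge_rel_sym.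
have E : components F = equivalence_partition (connect (edge_rel F)) setT.
  apply/setP => C; apply/imsetP/imsetP => -[x _ ->]; exists x; rewrite ?inE //.
    by apply/setP => y; rewrite !inE.
  by apply/setP => y; rewrite !inE.
have /card_partition : partition (components F) [set: T].
  rewrite E; apply: equivalence_partitionP => x y z _ _ _; split=> //.
  move=> xy; exact: same_connect.
rewrite cardsT => ->; rewrite /odd_cycles -sum1dep_card big_mkcondr /=.
elim/big_ind2: _ => // [a b c d|C _]; last by case: ifP.
by rewrite !oddD => -> ->.
Qed.

(** * Alternate colouring of even cycles *)

Section TwoRegular.

Variables (T : finType) (r : rel T).
Hypotheses (r_sym : symmetric r) (r_irr : irreflexive r).
Hypothesis r_2reg : forall x, #|[set y | r x y]| = 2.

(** Outside the neighbours of [x] this is the identity, which makes [other x] an involution on all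
    of [T], and hence [dart_next] injective on all pairs, as [fconnect_sym] demands. *)
Definition other (x y : T) : T :=
  if r x y then odflt y [pick z in [set z | r x z] :\ y] else y.

Lemma otherP x y : r x y ->
  [/\ r x (other x y), other x y != y &
      forall z, r x z -> z = y \/ z = other x y].
Proof.
move=> rxy; have ry : y \in [set z | r x z] by rewrite inE.
have := r_2reg x; rewrite (cardsD1 y) ry => -[] /eqP/cards1P[z Ez].
have -> : other x y = z.
  rewrite /other rxy Ez; case: pickP => [t|/(_ z)]; rewrite !inE ?eqxx //.
  by move/eqP.
have: z \in [set z | r x z] :\ y by rewrite Ez inE.
rewrite !inE => /andP[zy rxz]; split=> // t rxt.
case: (eqVneq t y) => [|ty]; [by left | right].
have : t \in [set z | r x z] :\ y by rewrite !inE ty.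
by rewrite Ez inE => /eqP.
Qed.

Lemma otherK x : involutive (other x).
Proof.
move=> y; case rxy: (r x y); last by rewrite /other !rxy.
have [r1 n1 _] := otherP rxy; have [r2 n2 /(_ _ rxy)[E|//]] := otherP r1.
by rewrite -E eqxx in n1.
Qed.

(** A dart is an oriented edge; [dart_next] walks on along its cycle without turning back. *)
Definition dart_rev (d : T * T) : T * T := (d.2, d.1).
Definition dart_next (d : T * T) : T * T := (d.2, other d.2 d.1).

Lemma dart_revK : involutive dart_rev. Proof. by case. Qed.

Lemma dart_next_rev d : dart_next (dart_rev (dart_next d)) = dart_rev d.
Proof. by case: d => x y; rewrite /dart_next /dart_rev /= otherK. Qed.

Lemma dart_next_inj : injective dart_next.
Proof.
apply: (can_inj (g := dart_rev \o dart_next \o dart_rev)) => d /=.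
by rewrite dart_next_rev dart_revK.
Qed.

Lemma dart_nextP d : r d.1 d.2 -> r (dart_next d).1 (dart_next d).2.
Proof. by rewrite r_sym => /otherP[]. Qed.

Let fsym := fconnect_sym dart_next_inj.

Lemma fconnect_dart d d' :
  fconnect dart_next d d' -> r d.1 d.2 -> r d'.1 d'.2.
Proof. by move=> /iter_findex <- rd; elim: (findex _ _ _) => //= n /dart_nextP. Qed.

(* If iterating dart_next reversed d, the dart halfway along would be its own
   reversal or would turn back on itself. *)
Lemma rev_notin_orbit d : r d.1 d.2 -> ~~ fconnect dart_next d (dart_rev d).
Proof.
move=> rd; apply/negP => /iter_findex; move: (findex _ _ _) => n.
have [k] := ubnP n; elim: k n d rd => // k IH [|[|n]] [x y] /= rd lt_nk.
- by case=> E _; rewrite E r_irr in rd.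
- case=> E; rewrite r_sym in rd; have [_ + _] := otherP rd.
  by rewrite E eqxx.
(* Cancelling one step at each end gives the same relation for [dart_next d], with two steps
   fewer. *)
rewrite -dart_next_rev => /dart_next_inj; rewrite -iterS iterSr.
by apply: IH; [exact: dart_nextP | exact: ltnW].
Qed.

(** Taking first end points maps the orbit bijectively onto the component: two darts of the orbit
    leaving the same vertex would put a dart and its reversal into one orbit. *)
Lemma order_dart d : r d.1 d.2 ->
  order dart_next d = #|[set y | connect r d.1 y]|.
Proof.
move=> rd; pose O := [set d' | fconnect dart_next d d'].
have -> : order dart_next d = #|O| by rewrite /O cardsE.
have injO : {in O &, injective fst}.
  move=> [p q] [p' s]; rewrite !inE /= => c1 c2 E; subst p'.
  have r1 := fconnect_dart c1 rd; have r2 := fconnect_dart c2 rd.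
  have [_ _ /(_ _ r2)[/= ->//|/= Es]] := otherP r1.
  case/negP: (rev_notin_orbit r1).
  apply: (@connect_trans _ _ (p, s)); first
    by rewrite fsym in c1; exact: connect_trans c1 c2.
  by rewrite fsym; apply: connect1; rewrite /= /dart_next /dart_rev /= Es.
rewrite -(card_in_imset injO); apply: eq_card => y; rewrite inE.
apply/imsetP/idP => [[d' + ->]|].
  rewrite inE => /iter_findex <-; elim: (findex _ _ _) => //= n IH.
  apply: connect_trans IH (connect1 _).
  by elim: n => //= n; exact: dart_nextP.
case/connectP=> p; elim/last_ind: p y => [|p z IH] y /=.
  by move=> _ ->; exists d; rewrite // inE.
rewrite rcons_path last_rcons => /andP[/IH/(_ erefl)[[u q] + Eu] + ->].
rewrite Eu inE /= => c ruz; have rq := fconnect_dart c rd.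
(* The neighbour [z] of [u] is the first end point of either the next dart or the previous one. *)
have [_ _ /(_ _ ruz)[->|->]] := otherP rq.
  exists (dart_next (u, q)); rewrite // inE.
  by apply: connect_trans c _; exact: fconnect1.
exists (other u q, u); rewrite // inE; apply: connect_trans c _.
by rewrite fsym; apply: connect1; rewrite /= /dart_next /= otherK.
Qed.

Hypothesis r_even : forall x, ~~ odd #|[set y | connect r x y]|.

Let base d := froot dart_next d.
Let index_odd d := odd (findex dart_next (base d) d).

Let base_next d : base (dart_next d) = base d.
Proof. by apply/esym/(rootP fsym); exact: fconnect1. Qed.

(** A step raises the position in the orbit by one, except on the return to the root, where it drops
    from the order minus one to 0; the parity flips there too because the order is even. *)
Let index_odd_next d : r d.1 d.2 -> index_odd (dart_next d) = ~~ index_odd d.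
Proof.
move=> rd; rewrite /index_odd base_next.
have c : fconnect dart_next (base d) d by rewrite fsym connect_root.
have ev : ~~ odd (order dart_next (base d)).
  rewrite order_dart ?r_even //; rewrite fsym in c; exact: fconnect_dart rd.
move: c ev; move: (base d) => b c ev.
have := findex_max c; rewrite -{2}(iter_findex c) -iterS leq_eqVlt.
move: (findex _ _ d) => n /orP[/eqP E|lt].
  rewrite E iter_order; last exact: dart_next_inj.
  by rewrite findex0 -E /= negbK in ev *; rewrite ev.
by rewrite findex_iter.
Qed.

Lemma even_two_regular_edge_coloring : exists c : T -> T -> bool,
  (forall x y, r x y -> c x y = c y x) /\
  (forall x y z, r x y -> r x z -> y != z -> c x y != c x z).
Proof.
pose rk d := enum_rank (base d) : nat.
(* A cycle carries two opposite orbits. The one whose root has the smaller rank orients it, so both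
   darts of an edge get the same colour. *)
pose c d := if rk d < rk (dart_rev d) then index_odd d else index_odd (dart_rev d).
have c_sym d : r d.1 d.2 -> c (dart_rev d) = c d.
  move=> rd; rewrite /c dart_revK; case: ltngtP => // /val_inj/enum_rank_inj.
  by move/esym/(rootP fsym) => F; case/negP: (rev_notin_orbit rd).
have base_rn d : base (dart_rev (dart_next d)) = base (dart_rev d).
  by rewrite -(base_next (dart_rev (dart_next d))) dart_next_rev.
have c_next d : r d.1 d.2 -> c (dart_next d) = ~~ c d.
  move=> rd; rewrite /c /rk base_next base_rn index_odd_next //.
  case: ifP => // _; rewrite -(dart_next_rev d) index_odd_next ?negbK //.
  by rewrite r_sym; exact: dart_nextP.
exists (fun x y => c (x, y)); split=> [x y rxy|x y z rxy rxz yz].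
  by rewrite -(c_sym (x, y)).
have [_ _ /(_ _ rxz)[E|E]] := otherP rxy; first by rewrite E eqxx in yz.
have -> : (x, z) = dart_next (y, x) by rewrite /dart_next /= E.
rewrite c_next /=; last by rewrite r_sym.
rewrite -(c_sym (x, y)) //; by rewrite /dart_rev /=; case: (c _).
Qed.

End TwoRegular.

(** * Three-edge-colourings *)

Definition edge_coloring (T C : eqType) (e : rel T) (col : T -> T -> C) : Prop :=
  (forall x y, col x y = col y x) /\
  (forall x y z, e x y -> e x z -> y != z -> col x y != col x z).

(* Tait: the edges outside the 2-factor receive None, and each even cycle
   is coloured alternately. *)
Lemma even_two_factor_coloring (T : finType) (e : rel T) (F : {set {set T}}) :
  symmetric e -> irreflexive e -> (forall x, #|[set y | e x y]| <= 3) ->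
  two_factor e F -> odd_cycles F = 0 ->
  exists col : T -> T -> option bool, edge_coloring e col.
Proof.
move=> e_sym e_irr e_cubic /andP[/subsetP FE /forallP degF] odd0.
have F2 f : f \in F -> #|f| = 2 by move/FE; exact: edge_card.
have rE x y : edge_rel F x y -> e x y by move=> /FE; rewrite mem_edges.
have r_irr : irreflexive (edge_rel F) by move=> x; apply/negP => /rE; rewrite e_irr.
have r_2reg x : #|[set y | edge_rel F x y]| = 2.
  by rewrite -degree_in_card //; apply/eqP.
have [|c [c_sym c_alt]] :=
    even_two_regular_edge_coloring (@edge_rel_sym T F) r_irr r_2reg.
  move=> x; apply/negP => oddx; have /eqP := odd0; rewrite cards_eq0 => /eqP/setP.
  move/(_ [set y | connect (edge_rel F) x y]); rewrite !inE oddx andbT.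
  by move/negP; apply; apply: imset_f.
exists (fun x y => if edge_rel F x y then Some (c x y) else None); split.
  move=> x y; rewrite edge_rel_sym; case: ifP => // ryx.
  by rewrite (c_sym _ _ ryx).
move=> x y z exy exz yz; case: ifP => rxy; case: ifP => rxz //.
  by apply: contraNneq (c_alt _ _ _ rxy rxz yz) => -[->].
(* If both edges lie outside [F], at most one neighbour of [x] is left for [F], against degree
   two. *)
have : [set t | edge_rel F x t] \subset ([set t | e x t] :\ y) :\ z.
  apply/subsetP => t; rewrite !(in_set, in_set1) => rxt; rewrite (rE _ _ rxt).
  apply/and3P; split=> //; apply: contraTneq rxt => ->; first by rewrite rxz.
  by rewrite rxy.
move/subset_leq_card; rewrite r_2reg.
have := e_cubic x; rewrite (cardsD1 y) inE exy (cardsD1 z) !inE exz eq_sym yz /=.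
by rewrite ltnS !add1n ltnS => le1 /leq_trans/(_ le1).
Qed.

(** * The graph G_alpha(m;1,1,1) *)

(* Ordered so that in cut_parity_block the last edge at each vertex can be
   eliminated in turn, its colour being forced by the first two. *)
Definition Galpha_nbs m (x : Galpha_vertex m) : seq (Galpha_vertex m) :=
  match x with
  | inl (u, i) =>
    match u with
    | vA => [:: inl (vA', ord_pred i); inl (vv, i); inl (x6, i)]
    | vB => [:: inl (vB', ord_pred i); inl (x2, i); inl (x1, i)]
    | vA' => [:: inl (vv, i); inl (x3, i); inl (vA, ordS i)]
    | vB' => [:: inl (x1, i); inl (x4, i); inl (vB, ordS i)]
    | vv => [:: inr i; inl (vA, i); inl (vA', i)]
    | x1 => [:: inl (vB, i); inl (x5, i); inl (vB', i)]
    | x2 => [:: inl (x6, i); inl (x4, i); inl (vB, i)]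
    | x3 => [:: inl (x4, i); inl (x5, i); inl (vA', i)]
    | x4 => [:: inl (x2, i); inl (x3, i); inl (vB', i)]
    | x5 => [:: inl (x6, i); inl (x3, i); inl (x1, i)]
    | x6 => [:: inl (vA, i); inl (x2, i); inl (x5, i)]
    end
  | inr i => [:: inr (ord_pred i); inl (vv, i); inr (ordS i)]
  end.

Lemma ord_pred_eq m (i j : 'I_m) : (i == ord_pred j) = (j == ordS i).
Proof. by rewrite -(can_eq (@ordSK m)) ord_predK eq_sym. Qed.

Lemma inl_eqE (A B : eqType) (a b : A) : (inl a == inl b :> A + B) = (a == b).
Proof. by []. Qed.

Lemma inr_eqE (A B : eqType) (a b : B) : (inr a == inr b :> A + B) = (a == b).
Proof. by []. Qed.

Ltac compute_mem :=
  repeat match goal with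
  | |- context [(?u, ?v) \in ?s] =>
    let b := eval vm_compute in ((u, v) \in s) in change ((u, v) \in s) with b
  end.

Lemma GalphaE m (x y : Galpha_vertex m) : Galpha x y = (y \in Galpha_nbs x).
Proof.
rewrite /Galpha; case: x y => [[u i]|i] [[u' j]|j] /=.
- case: u; case: u'; compute_mem;
    rewrite /= !in_cons in_nil !inl_eqE !xpair_eqE /= ?ord_pred_eq ?orbF //;
    exact: eq_sym.
- by case: u; rewrite !inE ?inr_eqE ?orbF //= eq_sym.
- by case: u'; rewrite !inE ?inl_eqE ?xpair_eqE ?orbF //= eq_sym.
- by rewrite !inE !inr_eqE ord_pred_eq orbC.
Qed.

Lemma Galpha_degree m (x : Galpha_vertex m) : #|[set y | Galpha x y]| <= 3.
Proof.
rewrite (eq_card (B := mem (Galpha_nbs x))); last by move=> y; rewrite inE GalphaE.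
by apply: leq_trans (card_size _) _; case: x => [[[] i]|i].
Qed.

Lemma iter_ordS m n (i : 'I_m) : iter n (@ordS m) i = (i + n) %% m :> nat.
Proof.
elim: n => [|n IH] /=; first by rewrite addn0 modn_small.
by rewrite IH -addn1 modnDml -addnA addn1.
Qed.

Lemma ordS_transitive m (i j : 'I_m) : exists n, j = iter n (@ordS m) i.
Proof.
(* From [i], [m - i] steps lead to index 0, and [j] more to [j]. *)
exists (m - i + j); apply: val_inj => /=.
by rewrite iter_ordS addnA subnKC ?modnDl ?modn_small // ltnW.
Qed.

Lemma ord_pred_neq_ordS m (i : 'I_m) : 2 < m -> ord_pred i != ordS i.
Proof.
move=> m_gt2; rewrite eq_sym ord_pred_eq; apply/eqP => /(congr1 val).
(* Equality would mean i + 2 = i, hence 2 = 0, modulo m. *)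
rewrite -[ordS (ordS i)]/(iter 2 (@ordS m) i).
have := eqn_modDl i 0 2 m; rewrite addn0 mod0n (modn_small m_gt2).
by rewrite (modn_small (ltn_ord i)) -iter_ordS => + E; rewrite -E eqxx.
Qed.

Lemma uniq_Galpha_nbs m (x : Galpha_vertex m) : 2 < m -> uniq (Galpha_nbs x).
Proof.
move=> m_gt2; case: x => [[[] i]|i] //=.
by rewrite !inE !inr_eqE (negPf (ord_pred_neq_ordS i m_gt2)).
Qed.

(** * The parity of a cut and its flip across a block *)

Definition color_succ (c : option bool) : option bool :=
  match c with
  | None => Some false | Some false => Some true | Some true => None
  end.

(* For pairwise distinct colours, the sign of the permutation (a, b, l);
   otherwise the cyclic orientation of the pair (repeated colour, single
   colour). *)
Definition cut_parity (a b l : option bool) : bool :=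
  if b == l then a == color_succ b
  else if a == b then l == color_succ a else b == color_succ a.

Definition third_color (a b : option bool) : option bool :=
  if color_succ a == b then color_succ b else color_succ a.

Lemma third_colorP a b c : uniq [:: a; b; c] -> a != b /\ c = third_color a b.
Proof. by case: a b c => [[]|] [[]|] [[]|]. Qed.

Definition all_colors (P : pred (option bool)) : bool :=
  all P [:: None; Some false; Some true].

Lemma all_colorsP P c : all_colors P -> P c.
Proof. by move=> /allP; apply; case: c => [[]|]. Qed.

(** Each of the twelve vertices of a block forces one colour, so nine free colours remain, that is
    3^9 cases. The premise keeps the rest of properness: the first two colours at each vertex
    differ. *)
Definition block_flips_parity (ia ib il av s e62 e24 e35 e43 : option bool) : bool :=
  let a6 := third_color ia av in let va' := third_color s av in
  let ol := third_color il s in let e65 := third_color a6 e62 in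
  let e2b := third_color e62 e24 in let e51 := third_color e65 e35 in
  let e1b := third_color ib e2b in let e1b' := third_color e1b e51 in
  let e4b' := third_color e24 e43 in let e3a' := third_color e43 e35 in
  let oa := third_color va' e3a' in let ob := third_color e1b' e4b' in
  [&& ia != av, s != av, il != s, a6 != e62, e62 != e24, e65 != e35, ib != e2b,
      e1b != e51, e24 != e43, e43 != e35, va' != e3a' & e1b' != e4b'] ==>
  (cut_parity oa ob ol == ~~ cut_parity ia ib il).

Lemma block_flips_parityT :
  all_colors (fun ia => all_colors (fun ib => all_colors (fun il =>
  all_colors (fun av => all_colors (fun s => all_colors (fun e62 =>
  all_colors (fun e24 => all_colors (fun e35 => all_colors (fun e43 =>
  block_flips_parity ia ib il av s e62 e24 e35 e43))))))))).
Proof. by vm_compute. Qed.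

(* ia, ib, il are the colours of the edges entering a block at A, B and w; oa, ob,
   ol those leaving it at A', B' and w; s is the spoke; the rest are named after
   their end points. *)
Lemma cut_parity_block (ia ib il oa ob ol s : option bool)
    (av a6 va' e62 e65 e24 e2b e43 e4b' e3a' e35 e51 e1b e1b' : option bool) :
  uniq [:: ia; av; a6] -> uniq [:: s; av; va'] -> uniq [:: il; s; ol] ->
  uniq [:: a6; e62; e65] -> uniq [:: e62; e24; e2b] ->
  uniq [:: e65; e35; e51] -> uniq [:: ib; e2b; e1b] ->
  uniq [:: e1b; e51; e1b'] -> uniq [:: e24; e43; e4b'] ->
  uniq [:: e43; e35; e3a'] -> uniq [:: va'; e3a'; oa] ->
  uniq [:: e1b'; e4b'; ob] ->
  cut_parity oa ob ol = ~~ cut_parity ia ib il.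
Proof.
do 12!(case/third_colorP => ? ->); have := block_flips_parityT.
move/all_colorsP=> /(_ ia) /all_colorsP-/(_ ib) /all_colorsP-/(_ il).
move/all_colorsP=> /(_ av) /all_colorsP-/(_ s) /all_colorsP-/(_ e62).
move/all_colorsP=> /(_ e24) /all_colorsP-/(_ e35) /all_colorsP-/(_ e43).
move/implyP=> flip; apply/eqP/flip.
by repeat (apply/andP; split).
Qed.

Lemma Galpha_not_edge_colorable m
    (col : Galpha_vertex m -> Galpha_vertex m -> option bool) :
  2 < m -> odd m -> ~ edge_coloring (@Galpha m) col.
Proof.
move=> m_gt2 m_odd [c_sym c_proper].
have U x : uniq (map (col x) (Galpha_nbs x)).
  rewrite map_inj_in_uniq ?uniq_Galpha_nbs // => y z; rewrite -!GalphaE => xy xz.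
  by apply: contra_eq; exact: c_proper.
pose f i := cut_parity (col (inl (vA, i)) (inl (vA', ord_pred i)))
  (col (inl (vB, i)) (inl (vB', ord_pred i))) (col (inr i) (inr (ord_pred i))).
have f_flip i : f (ordS i) = ~~ f i.
  rewrite /f ordSK (c_sym (inl (vA, _))) (c_sym (inl (vB, _)))
    (c_sym (inr (ordS i))).
  pose g u u' := col (inl (u, i)) (inl (u', i)).
  have gS u u' : col (inl (u, i)) (inl (u', i)) = g u u' by [].
  have gC u u' : g u u' = g u' u by exact: c_sym.
  (* Each inner edge gets one fixed orientation, so that the constraints at its two ends mention the
     same term. *)
  pose gE := (gC vv vA, gC vA' vv, gC x6 vA, gC x2 x6, gC x5 x6, gC x4 x2,
    gC vB x2, gC x3 x4, gC vB' x4, gC vA' x3, gC x5 x3, gC x1 x5, gC vB x1,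
    gC vB' x1).
  have UA := U (inl (vA, i)); have UB := U (inl (vB, i)).
  have UA' := U (inl (vA', i)); have UB' := U (inl (vB', i)).
  have Uv := U (inl (vv, i)); have Uw := U (inr i).
  have U1 := U (inl (x1, i)); have U2 := U (inl (x2, i)).
  have U3 := U (inl (x3, i)); have U4 := U (inl (x4, i)).
  have U5 := U (inl (x5, i)); have U6 := U (inl (x6, i)).
  rewrite /Galpha_nbs ![map _ _]/= !gS !(c_sym (inr i) (inl _)) ?gE
    in UA UB UA' UB' Uv Uw U1 U2 U3 U4 U5 U6.
  exact: (cut_parity_block UA Uv Uw U6 U2 U5 UB U1 U4 U3 UA' UB').
have f_iter n i : f (iter n (@ordS m) i) = odd n (+) f i.
  by elim: n => //= n IH; rewrite f_flip IH addNb.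
pose i0 : 'I_m := Ordinal (ltnW (ltnW m_gt2)).
(* Going once round the blocks returns to [i0] after an odd number of flips. *)
have := f_iter m i0; rewrite m_odd.
have -> : iter m (@ordS m) i0 = i0.
  by apply: val_inj; rewrite /= iter_ordS modnDr mod0n.
by case: (f i0).
Qed.

(** * An explicit 2-factor with at most two odd cycles *)

(* A 2-factor with the cycles formed by all w_i (length m), by all A_i, v_i, A'_i
   (length 3m), and one 8-cycle block_cycle in each block. *)
Definition factor_nbs m (x : Galpha_vertex m) : seq (Galpha_vertex m) :=
  match x with
  | inl (u, i) =>
    match u with
    | vA => [:: inl (vA', ord_pred i); inl (vv, i)]
    | vA' => [:: inl (vv, i); inl (vA, ordS i)]
    | vv => [:: inl (vA, i); inl (vA', i)]
    | vB => [:: inl (x2, i); inl (x1, i)]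
    | x2 => [:: inl (x6, i); inl (vB, i)]
    | x6 => [:: inl (x2, i); inl (x5, i)]
    | x5 => [:: inl (x6, i); inl (x3, i)]
    | x3 => [:: inl (x4, i); inl (x5, i)]
    | x4 => [:: inl (x3, i); inl (vB', i)]
    | vB' => [:: inl (x1, i); inl (x4, i)]
    | x1 => [:: inl (vB, i); inl (vB', i)]
    end
  | inr i => [:: inr (ord_pred i); inr (ordS i)]
  end.

Definition factor_rel m : rel (Galpha_vertex m) :=
  fun x y => y \in factor_nbs x.

Lemma uniq_factor_nbs m (x : Galpha_vertex m) : 2 < m -> uniq (factor_nbs x).
Proof.
move=> m_gt2; case: x => [[[] i]|i] //=.
by rewrite !inE !inr_eqE (negPf (ord_pred_neq_ordS i m_gt2)).
Qed.

Lemma factor_rel_sym m : symmetric (@factor_rel m).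
Proof.
rewrite /factor_rel => -[[u i]|i] [[u' j]|j].
- case: u; case: u';
    rewrite !in_cons !in_nil !inl_eqE !xpair_eqE /= ?ord_pred_eq ?orbF //;
    exact: eq_sym.
- by case: u.
- by case: u'.
- by rewrite !inE !inr_eqE !ord_pred_eq orbC.
Qed.

Lemma factor_rel_Galpha m (x y : Galpha_vertex m) : factor_rel x y -> Galpha x y.
Proof.
rewrite GalphaE; move: y; apply/allP.
by case: x => [[[] i]|i]; rewrite /= !inE !eqxx ?orbT.
Qed.

Definition block_cycle : seq G_vertex := [:: vB; x2; x6; x5; x3; x4; vB'; x1].

(** The eight vertices are closed under [factor_rel], which bounds the component from above;
    [block_cycle] lists them as a path, which bounds it from below. *)
Lemma factor_component m (u : G_vertex) (i : 'I_m) : u \in block_cycle ->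
  #|[set y | connect (@factor_rel m) (inl (u, i)) y]| = 8.
Proof.
move=> u_in; pose s : seq (Galpha_vertex m) := [seq inl (u, i) | u <- block_cycle].
have csym : connect_sym (@factor_rel m)
  by apply: sym_connect_sym; exact: factor_rel_sym.
have us : uniq s by rewrite map_inj_uniq // => a b [].
rewrite -[8]/(size s) -(card_uniqP us); apply: eq_card => y; rewrite inE.
have xs : (inl (u, i) : Galpha_vertex m) \in s by exact: map_f.
apply/idP/idP => [c|ys].
  rewrite -(closed_connect _ c) //; apply: intro_closed => // x z.
  move=> xz /mapP[a a_in Ex]; move: z xz; rewrite {x}Ex; apply/allP.
  by case: a a_in => // _; rewrite /= !inE !eqxx ?orbT.
have sub : subpred (mem s) (connect (@factor_rel m) (inl (vB, i))).
  by apply: path_connect; rewrite /= /factor_rel !inE !eqxx ?orbT.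
by apply: (connect_trans _ (sub _ ys)); rewrite csym; exact: sub.
Qed.

Lemma connect_ordS_cycle m (T : finType) (r : rel T) (f : 'I_m -> T) :
  (forall i, connect r (f i) (f (ordS i))) -> forall i j, connect r (f i) (f j).
Proof.
move=> step i j; have [n ->] := ordS_transitive i j.
by elim: n => //= n IH; exact: connect_trans IH (step _).
Qed.

Lemma odd_factor_component m (i : 'I_m) (x : Galpha_vertex m) :
  let comp z := [set y | connect (@factor_rel m) z y] in
  odd #|comp x| -> (comp x == comp (inr i)) || (comp x == comp (inl (vA, i))).
Proof.
move=> comp oddx.
have csym : connect_sym (@factor_rel m)
  by apply: sym_connect_sym; exact: factor_rel_sym.
have eq_comp y z : connect (@factor_rel m) y z -> comp y == comp z.
  move=> c; apply/eqP/setP => t; rewrite !inE; exact: same_connect.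
have cA a b : connect (@factor_rel m) (inl (vA, a)) (inl (vA, b)).
  move: a b; apply: connect_ordS_cycle => a.
  apply: (@connect_trans _ _ (inl (vA', a))); last first.
    by apply: connect1; rewrite /factor_rel !inE eqxx ?orbT.
  apply: (@connect_trans _ _ (inl (vv, a)));
    by apply: connect1; rewrite /factor_rel !inE eqxx ?orbT.
case: x oddx => [[u j]|j] oddx; apply/orP; last first.
  left; apply: eq_comp; move: j i {oddx}; apply: connect_ordS_cycle => a.
  by apply: connect1; rewrite /factor_rel !inE eqxx ?orbT.
have [u_in|] := boolP (u \in block_cycle).
  by rewrite /comp factor_component in oddx.
(* Here [vA] is settled by [cA]; [vA'] is reached from the [vA] of the next block, and [vv] from
   that of its own. *)
case: u {oddx} => // _; right; apply: eq_comp => //.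
  rewrite csym; apply: connect_trans (cA i (ordS j)) _.
  by apply: connect1; rewrite /factor_rel !inE ordSK eqxx ?orbT.
rewrite csym; apply: connect_trans (cA i j) _.
by apply: connect1; rewrite /factor_rel !inE eqxx ?orbT.
Qed.

Lemma Galpha_two_factor m : 2 < m ->
  exists2 F, two_factor (@Galpha m) F & odd_cycles F <= 2.
Proof.
move=> m_gt2; pose F := edges (@factor_rel m).
have irr : irreflexive (@factor_rel m).
  by move=> x; apply/negP => /factor_rel_Galpha; rewrite Galpha_irrefl.
have FE : edge_rel F =2 @factor_rel m.
  by move=> x y; rewrite /edge_rel mem_edges //; exact: factor_rel_sym.
exists F.
  apply/andP; split.
    apply/subsetP => f; rewrite !inE.
    move=> /existsP[x /existsP[y /andP[/factor_rel_Galpha xy Ef]]].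
    by apply/existsP; exists x; apply/existsP; exists y; rewrite xy.
  apply/forallP => x; rewrite degree_in_card; last by move=> f; exact: edge_card.
  rewrite (eq_card (B := mem (factor_nbs x))); last by move=> y; rewrite inE FE.
  by rewrite (card_uniqP (uniq_factor_nbs x m_gt2)); case: x => [[[] i]|i].
pose i0 : 'I_m := Ordinal (ltnW (ltnW m_gt2)).
pose comp z := [set y | connect (@factor_rel m) z y].
apply: (@leq_trans #|[set comp (inr i0); comp (inl (vA, i0))]|); last first.
  by rewrite cards2; case: (_ != _).
apply: subset_leq_card; apply/subsetP => C; rewrite inE => /andP[/imsetP[x _ ->]].
have -> : [set y | connect [rel a b | [set a; b] \in F] x y] = comp x.
  by apply/setP => y; rewrite !inE; exact: eq_connect.
by rewrite !inE; exact: odd_factor_component.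
Qed.

Theorem theorem4 (k : nat) (hk : 1 <= k) : oddness_is (@Galpha (2 * k + 1)) 2.
Proof.
set m := 2 * k + 1.
have m_gt2 : 2 < m by rewrite /m addn1 ltnS -[2]muln1 leq_mul2l.
have m_odd : odd m by rewrite /m addn1 /= mul2n odd_double.
have lower F : two_factor (@Galpha m) F -> 2 <= odd_cycles F.
  move=> F2; have := odd_odd_cycles F.
  have -> : odd #|Galpha_vertex m| = false.
    by rewrite card_sum card_prod card_ord cardE enumT unlock oddD oddM m_odd.
  (* Parity excludes a single odd cycle, so only the case of none is left to refute. *)
  case E: (odd_cycles F) => [|[|n]] // _.
  have [col colP] := even_two_factor_coloring (@Galpha_sym m) 
    (Galpha_irrefl m_gt2) (@Galpha_degree m) F2 E.
  by case: (Galpha_not_edge_colorable m_gt2 m_odd colP).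
split=> //; have [F F2 le2] := Galpha_two_factor m_gt2.
by exists F => //; apply/eqP; rewrite eqn_leq le2 lower.
Qed.
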